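(* Let $p\geq 1$ and $n\geq p+1$ be integers. Then the number of edges of the Fibonacci $p$-cube $\Gamma^{p}_{n}$ is $$|E(\Gamma^{p}_{n})|=\sum_{i=1}^{n}F^{p}_{i}F^{p}_{n-i+1}.$$
   Context: For $p\geq 1$, the Fibonacci $p$-numbers are defined by $F^p_0=0$, $F^p_1=F^p_2=\cdots=F^p_p=1$, and $F^p_n=F^p_{n-1}+F^p_{n-p-1}$ for $n>p$. A Fibonacci $p$-string of length $n$ is a binary string of length $n$ in which any two 1s are separated by at least $p$ 0s. The Fibonacci $p$-cube $\Gamma^p_n$ is the subgraph of the hypercube $Q_n$ (vertices: binary strings of length $n$, adjacent iff they differ in exactly one coordinate) induced by all Fibonacci $p$-strings of length $n$. *)

(* Defs.v *)
From mathcomp Require Import all_boot.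
Set Implicit Arguments.
Unset Strict Implicit.
Unset Printing Implicit Defensive.

(* At n = m.+1 the indices n - 1 and n - p - 1 of the recurrence are m and
   m - p, and the initial range 1 <= n <= p is m < p. *)
Fixpoint fibp (p n : nat) {struct n} : nat :=
  if n is m.+1 then
    if m < p then 1 else fibp p m + fibp p (m - p)
  else 0.

Lemma fibp0 p : fibp p 0 = 0.
Proof. by []. Qed.

Lemma fibp_init p n : 1 <= n <= p -> fibp p n = 1.
Proof. by case: n => //= m ->. Qed.

Lemma fibp_rec p n : p < n -> fibp p n = fibp p (n - 1) + fibp p (n - p - 1).
Proof. by case: n => //= m; rewrite ltnS leqNgt subn1 subnAC subn1 => /negbTE ->. Qed.

(* Undirected edges, as the two-element sets of adjacent vertices; meant for
   a symmetric irreflexive e. *)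
Definition edges (T : finType) (e : rel T) : {set {set T}} :=
  [set [set x; y] | x in T, y in T & e x y].

Definition hypercube (n : nat) : rel (n.-tuple bool) :=
  fun s t => #|[set i : 'I_n | tnth s i != tnth t i]| == 1.

Definition induced (T : finType) (e : rel T) (P : pred T) : rel {x : T | P x} :=
  fun u v => e (val u) (val v).

Definition fib_string (p n : nat) (s : n.-tuple bool) : bool :=
  [forall i : 'I_n, forall j : 'I_n,
     [&& i < j, tnth s i & tnth s j] ==>
     (p <= #|[set k : 'I_n | (i < k < j) && ~~ tnth s k]|)].

Definition fib_cube (p n : nat) : rel {s : n.-tuple bool | fib_string p s} :=
  @induced _ (@hypercube n) (@fib_string p n).

Arguments fib_cube : clear implicits.

Lemma fib_cube_sym p n : symmetric (fib_cube p n).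
Proof.
move=> u v; rewrite /fib_cube /induced /hypercube.
by congr (#|pred_of_set _| == 1); apply/setP=> i; rewrite !inE eq_sym.
Qed.

Lemma fib_cube_irr p n : irreflexive (fib_cube p n).
Proof.
move=> u; rewrite /fib_cube /induced /hypercube.
by rewrite (_ : [set _ | _] = set0) ?cards0 //; apply/setP=> i; rewrite !inE eqxx.
Qed.

(* Main.v *)
Require Import Defs.
From mathcomp Require Import all_boot.
From mathcomp Require Import zify.

Set Implicit Arguments.
Unset Strict Implicit.
Unset Printing Implicit Defensive.

Local Arguments fibp : simpl never.

(** A valid string together with one of its 1s determines the edge obtained by
    switching that 1 off, and every edge arises exactly once in this way; so the
    number of edges is the total number of 1s in all valid strings. Scanning a
    string from the left and remembering only the number [c] of 0s still owed
    before the next 1, both the number of valid strings and their total number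
    of 1s satisfy recurrences in the length, solved by induction for all
    [c <= p] simultaneously. *)

Fixpoint spaced (p c : nat) (s : seq bool) : bool :=
  if s is b :: s' then
    if b then (c == 0) && spaced p p s' else spaced p c.-1 s'
  else true.

(** The first conjunct is trivial at [c = 0], the case of interest. It is carried along because,
    after a leading 1, its instance at [c = p] is the gap condition between that 1 and all later
    ones. *)
Lemma spacedP p c s :
  reflect ((forall i, nth false s i -> c <= i) /\
           (forall i j, i < j -> nth false s i -> nth false s j -> i + p < j))
          (spaced p c s).
Proof.
elim: s c => [|[] s IHs] c /=.
- by apply: ReflectT; split=> [i|i j _]; rewrite nth_nil.
- apply: (iffP andP) => [[/eqP-> /IHs[first gap]]|[first gap]]; split=> //.
  + move=> [|i] [|j] //= ij; first by move=> _ /first; lia.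
    by move=> si sj; have := gap i j ij si sj; lia.
  + by have := first 0 isT; lia.
  + apply/IHs; split=> [j sj|i j ij si sj].
      by have := gap 0 j.+1 isT isT sj; lia.
    by have := gap i.+1 j.+1 ij si sj; lia.
- apply: (iffP (IHs _)) => -[first gap]; split.
  + by move=> [|i] //= /first; lia.
  + by move=> [|i] [|j] //= ij si sj; have := gap i j ij si sj; lia.
  + by move=> i si; have := first i.+1 si; lia.
  + by move=> i j ij si sj; have := gap i.+1 j.+1 ij si sj; lia.
Qed.

Lemma card_ord_itv n a b : b <= n -> #|[set k : 'I_n | a <= k < b]| = b - a.
Proof.
move=> le_bn; rewrite cardsE -sum1_card.
rewrite -[RHS]mul1n mulnC -sum_nat_const_nat (big_nat_widen _ _ _ _ _ le_bn).
by rewrite big_geq_mkord; apply: eq_bigl => k; rewrite andbC.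
Qed.

Lemma fib_string_spaced p n (s : n.-tuple bool) : fib_string p s = spaced p 0 s.
Proof.
apply/idP/spacedP => [fib_s|[_ gap]].
  split=> // i j ij si sj.
  have ltn k : nth false s k -> k < n.
    by apply: contraTT; rewrite -leqNgt => ?; rewrite nth_default ?size_tuple.
  pose i' := Ordinal (ltn _ si); pose j' := Ordinal (ltn _ sj).
  move/forallP: fib_s => /(_ i')/forallP/(_ j')/implyP.
  rewrite !(tnth_nth false) /= ij si sj => /(_ isT) le_p.
  (* The 0s counted by [le_p] are among the [j - i.+1] positions strictly between [i] and [j]. *)
  suff: p <= j - i.+1 by lia.
  rewrite -(@card_ord_itv n) ?(ltnW (ltn _ sj)) //.
  apply: leq_trans le_p _; apply: subset_leq_card.
  by apply/subsetP=> k; rewrite !inE => /andP[].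
apply/forallP=> i; apply/forallP=> j; apply/implyP.
rewrite !(tnth_nth false) => /and3P[ij si sj].
have ipj := gap i j ij si sj.
have le_n : (i + p).+1 <= n by have := ltn_ord j; lia.
(* The [p] positions following the 1 at [i] already are 0s lying before [j]. *)
have <- : #|[set k : 'I_n | i.+1 <= k < (i + p).+1]| = p.
  by rewrite card_ord_itv //; lia.
apply: subset_leq_card; apply/subsetP=> k; rewrite !inE => /andP[ik kip].
have kj : k < j by lia.
rewrite ik kj /=; apply/negP; rewrite (tnth_nth false) => sk.
by have := gap i k ik si sk; lia.
Qed.

Lemma sum_tuple_cons m (P : pred (seq bool)) (F : seq bool -> nat) :
  \sum_(s : m.+1.-tuple bool | P s) F s =
    \sum_(s : m.-tuple bool | P (true :: s)) F (true :: s) +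
    \sum_(s : m.-tuple bool | P (false :: s)) F (false :: s).
Proof.
pose h (x : bool * m.-tuple bool) := cons_tuple x.1 x.2.
have bij_h : bijective h.
  exists (fun s : m.+1.-tuple bool => (thead s, [tuple of behead s])).
    by case=> b s; congr (_, _); apply: val_inj.
  by move=> s; rewrite [RHS]tuple_eta.
rewrite (reindex h) /=; last exact: onW_bij.
rewrite -(pair_big_dep xpredT (fun b (s : m.-tuple bool) => P (b :: s))
            (fun b (s : m.-tuple bool) => F (b :: s))).
by rewrite big_bool.
Qed.

Lemma sum_tuple0 (P : pred (seq bool)) (F : seq bool -> nat) :
  P [::] -> \sum_(s : 0.-tuple bool | P s) F s = F [::].
Proof.
move=> P0; rewrite (big_pred1 [tuple]) // => s.
by rewrite (tuple0 s) P0; apply/esym/eqP.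
Qed.

(* In the initial range the second term vanishes because [m.+1 - p] is
   truncated to [0]. *)
Lemma fibpSS p m : fibp p m.+2 = fibp p m.+1 + fibp p (m.+1 - p).
Proof.
case: (ltnP m.+1 p) => [lt_mp|le_pm].
  rewrite (_ : m.+1 - p = 0); last by lia.
  by rewrite fibp0 addn0 !fibp_init; lia.
by rewrite fibp_rec //; congr (fibp _ _ + fibp _ _); lia.
Qed.

Lemma card_spaced p c m : 0 < p -> c <= p ->
  \sum_(s : m.-tuple bool | spaced p c s) 1 = fibp p (m + p + 1 - c).
Proof.
move=> p_gt0; elim: m c => [|m IHm] c le_cp.
  rewrite (@sum_tuple0 (spaced p c) (fun=> 1)) //.
  (* The index [p + 1 - c] lies in the initial range unless [c = 0]; there one unfolding gives
     [fibp p p + fibp p 0 = 1]. *)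
  case: c le_cp => [|c] le_cp; last by rewrite fibp_init //; lia.
  rewrite fibp_rec; last by lia.
  rewrite (_ : _ - p - 1 = 0); last by lia.
  by rewrite fibp_init //; lia.
rewrite (@sum_tuple_cons m (spaced p c) (fun=> 1)) /=.
case: c le_cp => [|c] le_cp /=.
  (* A leading 1 creates the debt [p] and index [m.+1], a leading 0 gives index [(m + p).+1]: the
     two terms of the recurrence. *)
  rewrite !IHm //; rewrite (_ : m.+1 + p + 1 - 0 = (m + p).+2); last by lia.
  by rewrite fibpSS addnC; congr (fibp _ _ + fibp _ _); lia.
(* A leading 0 is forced; length and debt drop together, so the index is unchanged. *)
rewrite big_pred0 // IHm; last by lia.
by congr fibp; lia.
Qed.

(* The [j]-th summand counts the 1s in position [j]: [fibp p (j.+1 - c)] is the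
   number of prefixes and [fibp p (m - j)] the number of suffixes. *)
Lemma sum_ones_spaced p c m : 0 < p -> c <= p ->
  \sum_(s : m.-tuple bool | spaced p c s) count id s =
    \sum_(j < m) fibp p (j.+1 - c) * fibp p (m - j).
Proof.
move=> p_gt0; elim: m c => [|m IHm] c le_cp.
  by rewrite (@sum_tuple0 (spaced p c) (count id)) // big_ord0.
rewrite (@sum_tuple_cons m (spaced p c) (count id)) /= big_ord_recl.
case: c le_cp => [|c] le_cp /=.
  rewrite big_split /= card_spaced // !IHm // !subn0.
  rewrite [fibp p 1]fibp_init // mul1n (_ : m + p + 1 - p = m.+1); last by lia.
  rewrite -addnA -big_split /=; congr (_ + _); apply: eq_bigr => j _.
  (* The debts [p] and [0] left by the two leading letters contribute prefix factors
     [fibp p (j.+1 - p)] and [fibp p j.+1], which add up to [fibp p j.+2]. *)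
  by rewrite /bump leq0n add1n !subn0 subSS fibpSS -mulnDl addnC.
rewrite big_pred0 // IHm; last by lia.
by rewrite subSS sub0n mul0n; apply: eq_bigr => j _.
Qed.

Definition switch_off n (s : n.-tuple bool) (i : 'I_n) : n.-tuple bool :=
  [tuple tnth s k && (k != i) | k < n].

Lemma tnth_switch_off n (s : n.-tuple bool) i k :
  tnth (switch_off s i) k = tnth s k && (k != i).
Proof. exact: tnth_mktuple. Qed.

(** Every surviving pair of 1s keeps all the 0s that were between them. *)
Lemma fib_string_switch_off p n (s : n.-tuple bool) i :
  fib_string p s -> fib_string p (switch_off s i).
Proof.
move=> /forallP fib_s; apply/forallP=> j; apply/forallP=> k; apply/implyP.
rewrite !tnth_switch_off => /and3P[jk /andP[sj _] /andP[sk _]].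
have /forallP/(_ k) := fib_s j; rewrite jk sj sk /= => /leq_trans; apply.
apply: subset_leq_card; apply/subsetP=> l; rewrite !inE tnth_switch_off.
by case: (tnth s l); rewrite /= ?andbF.
Qed.

Lemma switch_off_hypercube n (s : n.-tuple bool) i :
  tnth s i -> hypercube s (switch_off s i).
Proof.
move=> si; apply/cards1P; exists i; apply/setP=> k; rewrite !inE tnth_switch_off.
by case: (eqVneq k i) => [->|_]; rewrite ?si ?andbT ?eqxx.
Qed.

Lemma hypercube_switch_off n (s t : n.-tuple bool) : hypercube s t ->
  exists i, (tnth s i /\ t = switch_off s i) \/ (tnth t i /\ s = switch_off t i).
Proof.
case/cards1P=> i /setP diff; exists i.
have eq_st k : (tnth s k == tnth t k) = (k != i).
  by have := diff k; rewrite !inE => <-; rewrite negbK.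
have := eq_st i; rewrite eqxx /=.
case si: (tnth s i); case ti: (tnth t i) => // _; [left|right]; split=> //;
  apply: eq_from_tnth => k; rewrite tnth_switch_off;
  have := eq_st k; case: (eqVneq k i) => [->|_] /=; rewrite ?andbT ?andbF //.
- by move/eqP.
- by move/eqP.
Qed.

Lemma card_edges_fib_cube p n :
  #|edges (fib_cube p n)| =
    \sum_(s : n.-tuple bool | fib_string p s) count id s.
Proof.
pose V : finType := {s : n.-tuple bool | fib_string p s}.
pose off (u : V) i : V := Sub _ (fib_string_switch_off i (valP u)).
pose A := [set x : V * 'I_n | tnth (val x.1) x.2].
pose f (x : V * 'I_n) := [set x.1; off x.1 x.2].
have -> : edges (fib_cube p n) = f @: A.
  apply/setP=> e; apply/imset2P/imsetP => [[u v _]|[[u i]]]; rewrite inE.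
    case/hypercube_switch_off=> i [[ui def_v]|[vi def_u]] ->.
    + exists (u, i); rewrite ?inE // /f /=; congr [set _; _].
      exact: val_inj.
    + exists (v, i); rewrite ?inE // /f /= setUC; congr [set _; _].
      exact: val_inj.
  by move=> /= ui ->; exists u (off u i); rewrite // inE; apply: switch_off_hypercube.
have offN u i : tnth (val (off u i)) i = false by rewrite tnth_switch_off eqxx andbF.
(* Injectivity: the edge determines its endpoint with more 1s, and then the position switched
   off. *)
rewrite card_in_imset; last first.
  move=> [u i] [v j]; rewrite !inE /= => ui vj eq_f.
  have : u \in f (v, j) by rewrite -eq_f !inE eqxx.
  rewrite !inE /= => /orP[/eqP eq_uv|/eqP u_off].
    subst v; congr (_, _).
    have : off u i \in f (u, j) by rewrite -eq_f !inE eqxx orbT.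
    rewrite !inE /= => /orP[/eqP off_u|/eqP eq_off].
      by move: ui; rewrite -[in X in X -> _]off_u offN.
    have := offN u i; rewrite eq_off tnth_switch_off ui /=.
    by move/negbFE/eqP.
  (* Here [u] has a 0 at [j]. Since [v] is [u] or [off u i], it has a 0 there too, against [vj]. *)
  have : v \in f (u, i) by rewrite eq_f !inE eqxx.
  rewrite !inE /= => /orP[/eqP eq_vu|/eqP v_off].
    by have := offN v j; rewrite -u_off -eq_vu vj.
  have := offN v j; rewrite -u_off => uj.
  by move: vj; rewrite v_off tnth_switch_off uj.
have count_ones (s : n.-tuple bool) : count id s = \sum_(i < n | tnth s i) 1.
  by rewrite -sum1_count big_tuple.
rewrite (eq_bigr _ (fun s _ => count_ones s)).
rewrite (reindex_omap (val : V -> _) insub) /=; last first.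
  by move=> s fib_s; rewrite insubT.
rewrite -sum1_card (eq_bigl (fun x : V * 'I_n => true && tnth (val x.1) x.2)).
  rewrite -(pair_big_dep xpredT (fun (u : V) i => tnth (val u) i) (fun _ _ => 1)) /=.
  by apply: eq_bigl => u; rewrite valK eqxx (valP u).
by move=> x; rewrite inE.
Qed.

Theorem theorem4p2 (p n : nat) (hp : 1 <= p) (hn : p + 1 <= n) :
  #|edges (fib_cube p n)| =
    \sum_(1 <= i < n.+1) fibp p i * fibp p (n - i + 1).
Proof.
rewrite card_edges_fib_cube (eq_bigl _ _ (@fib_string_spaced p n)).
rewrite sum_ones_spaced // big_add1 big_mkord; apply: eq_bigr => j _.
by rewrite subn0; congr (_ * fibp _ _); case: j => j /= lt_jn; lia.
Qed.
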